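(* Let $\Lambda \subset \mathbb{R}^2$ be a full-rank lattice with successive minima $\lambda_1, \lambda_2$ and corresponding minimal basis vectors $x_1, x_2$. A deep hole $z$ of $\Lambda$ has finite order in the group $\mathbb{R}^2/\Lambda$ if and only if $\Lambda$ is orthogonal or there exist rational numbers $p, q$ so that $$p\lambda_1^2 = x_1 \cdot x_2 = q\lambda_2^2.$$ Moreover, if $\lambda_1^2, \lambda_2^2, x_1 \cdot x_2 \in \mathbb{Z}$, then the order of $z$ in $\mathbb{R}^2/\Lambda$ is $\leq 12\sqrt{3}\,\lambda_2^4$.
   Context: The successive minima of a rank-$2$ lattice $\Lambda \subset \mathbb{R}^2$ are $\lambda_i = \min\{ r \in \mathbb{R} : \dim_{\mathbb{R}} \operatorname{span}_{\mathbb{R}}(B(r) \cap \Lambda) \geq i\}$, $i = 1,2$, where $B(r)$ is the closed disc of radius $r$ centered at the origin. A minimal basis of $\Lambda$ is a basis $x_1, x_2$ of $\Lambda$ with $\|x_1\| = \lambda_1$, $\|x_2\| = \lambda_2$ and such that the angle between $x_1$ and $x_2$ lies in $[\pi/3, \pi/2]$; every rank-$2$ lattice in $\mathbb{R}^2$ has such a basis. A lattice is orthogonal if it has a basis of pairwise orthogonal vectors. A vector $z \in \mathbb{R}^2$ is a deep hole of $\Lambda$ if $d(z,\Lambda) = \max\{ d(y,\Lambda) : y \in \mathbb{R}^2 \}$, where $d(y,\Lambda) = \min\{\|x-y\| : x \in \Lambda\}$. The order of $z$ in $\mathbb{R}^2/\Lambda$ is the order of the coset $z + \Lambda$ in the additive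 quotient group. *)

(* Defs.v *)
From mathcomp Require Import all_boot all_order all_algebra.
From mathcomp Require Import ring_quotient.
From mathcomp Require Import all_classical all_reals all_analysis.

Set Implicit Arguments.
Unset Strict Implicit.
Unset Printing Implicit Defensive.

Import Order.TTheory GRing.Theory Num.Theory.
Local Open Scope classical_set_scope.
Local Open Scope ring_scope.

Definition is_min d (T : porderType d) (A : set T) (m : T) : Prop :=
  A m /\ lbound A m.
Definition is_max d (T : porderType d) (A : set T) (m : T) : Prop :=
  A m /\ ubound A m.

Section Plane.
Variable R : realType.
Implicit Types (x y z : 'rV[R]_2) (L : zmodClosed 'rV[R]_2).

Definition dot x y : R := (x *m y^T) 0 0.

(* The library's norm on ['rV[R]_2] is the sup norm, hence this definition. *)
Definition enorm x : R := Num.sqrt (dot x x).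

Definition vangle x y : R := acos (dot x y / (enorm x * enorm y)).

Definition closed_disc (r : R) : set 'rV[R]_2 := [set x | enorm x <= r].

(* [W] is the linear span of a possibly infinite set [A]; the library's
   [<<X>>%VS] only takes finite sequences. *)
Definition is_span (A : set 'rV[R]_2) (W : {vspace 'rV[R]_2}) : Prop :=
  (forall x, A x -> x \in W) /\
  (forall W' : {vspace 'rV[R]_2},
     (forall x, A x -> x \in W') -> (W <= W')%VS).

Definition lattice_basis L x y : Prop :=
  free [:: x; y] /\
  (forall v, v \in L <-> exists m n : int, v = x *~ m + y *~ n).

Definition full_rank_lattice L : Prop := exists x y, lattice_basis L x y.

Definition successive_minimum L (i : nat) (l : R) : Prop :=
  is_min [set r | exists W, is_span (closed_disc r `&` [set` L]) W /\
                            (i <= \dim W)%N] l.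

Definition minimal_basis L x1 x2 : Prop :=
  [/\ lattice_basis L x1 x2,
      successive_minimum L 1 (enorm x1),
      successive_minimum L 2 (enorm x2) &
      pi / 3 <= vangle x1 x2 <= pi / 2].

Definition orthogonal_lattice L : Prop :=
  exists y1 y2, lattice_basis L y1 y2 /\ dot y1 y2 = 0.

Definition is_dist L y (d : R) : Prop :=
  is_min [set enorm (x - y) | x in [set` L]] d.

Definition deep_hole L z : Prop :=
  exists d, is_dist L z d /\ is_max [set e | exists y, is_dist L y e] d.

End Plane.

Definition finite_order (G : zmodType) (g : G) : Prop :=
  exists n : nat, (0 < n)%N /\ g *+ n = 0.

Definition has_order (G : zmodType) (g : G) (n : nat) : Prop :=
  is_min [set m : nat | (0 < m)%N /\ g *+ m = 0] n.

Definition lattice_coset (R : realType) (L : zmodClosed 'rV[R]_2)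
    (z : 'rV[R]_2) : Quotient.quot L :=
  (\pi_(Quotient.quot L) z)%qT.

(* Main.v *)
Require Import Defs.
From mathcomp Require Import all_boot all_order all_algebra.
From mathcomp Require Import all_classical all_reals all_analysis.
From mathcomp Require Import ring_quotient ring lra zify.

(** Put [a = dot x1 x1], [b = dot x1 x2], [c = dot x2 x2].  Minimality of the
    basis, together with the bounds on its angle, gives [0 <= b],
    [2 * b <= a <= c] ([minimal_basis_reduced]).  Such a reduced basis spans a
    triangle [0, x1, x2] without obtuse angle; let [p] be its circumcenter,
    the point with [dot p x1 = a / 2] and [dot p x2 = c / 2].

    The deep holes are exactly the translates of [p] and [- p] by lattice
    vectors ([deep_hole_circumcenter] proves the inclusion that matters).  On
    the one hand no lattice point is closer to [p] than [0]
    ([empty_circumcircle]).  On the other hand any point of the plane is,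
    modulo the lattice and up to sign, a point [w] of the triangle, and
    averaging the squared distances from [w] to the three vertices with the
    barycentric weights of [w] gives |p|^2 - |w - p|^2 ([triangle_dist]); so a
    vertex is strictly closer than |p| unless [w = p].

    Hence a deep hole has finite order iff both coordinates [s], [t] of [p] in
    the basis are rational.  They satisfy

      [s * a + t * b = a / 2],   [s * b + t * c = c / 2],   [s, t > 0].

    If [s] and [t] are rational, dividing by [t] and by [s] exhibits [b] as a
    rational multiple of [a] and of [c].  Conversely, if [b = P * a = Q * c],
    then solving the system gives [s = (1 - P) / (2 * (1 - P * Q))] and
    symmetrically for [t], which are rational.  An orthogonal basis is itself
    reduced, so the description of deep holes applies to it directly, and then
    [p] is half the sum of the two basis vectors, of order 2.

    Finally, by Cramer's rule [s = c * (a - b) / (2 * (a * c - b ^ 2))], and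
    symmetrically for [t].  When [a], [b], [c] are integers the order is
    therefore at most [2 * (a * c - b ^ 2) <= 2 * c ^ 2], well below the
    required bound. *)

Set Implicit Arguments.
Unset Strict Implicit.
Unset Printing Implicit Defensive.

Import Order.TTheory GRing.Theory Num.Theory.
Local Open Scope ring_scope.

(** * The Euclidean inner product *)

Lemma dotC (R : realType) (x y : 'rV[R]_2) : dot x y = dot y x.
Proof. by rewrite /dot -[x in LHS]trmxK -trmx_mul mxE. Qed.

Lemma dotDl (R : realType) (x y z : 'rV[R]_2) :
  dot (x + y) z = dot x z + dot y z.
Proof. by rewrite /dot mulmxDl mxE. Qed.

Lemma dotZl (R : realType) (k : R) (x z : 'rV[R]_2) :
  dot (k *: x) z = k * dot x z.
Proof. by rewrite /dot -scalemxAl mxE. Qed.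

Lemma dotNl (R : realType) (x z : 'rV[R]_2) : dot (- x) z = - dot x z.
Proof. by rewrite -scaleN1r dotZl mulN1r. Qed.

Lemma dotDr (R : realType) (x y z : 'rV[R]_2) :
  dot z (x + y) = dot z x + dot z y.
Proof. by rewrite dotC dotDl !(dotC _ z). Qed.

Lemma dotZr (R : realType) (k : R) (x z : 'rV[R]_2) :
  dot z (k *: x) = k * dot z x.
Proof. by rewrite dotC dotZl dotC. Qed.

Lemma dotNr (R : realType) (x z : 'rV[R]_2) : dot z (- x) = - dot z x.
Proof. by rewrite dotC dotNl dotC. Qed.

Definition dot_bilinear (R : realType) :=
  (@dotDl R, @dotDr R, @dotNl R, @dotNr R, @dotZl R, @dotZr R).

Lemma dot_sum_sqr (R : realType) (x : 'rV[R]_2) :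
  dot x x = \sum_j x 0 j ^+ 2.
Proof. by rewrite /dot mxE; apply: eq_bigr => j _; rewrite mxE expr2. Qed.

Lemma dot_ge0 (R : realType) (x : 'rV[R]_2) : 0 <= dot x x.
Proof. by rewrite dot_sum_sqr; apply: sumr_ge0 => j _; apply: sqr_ge0. Qed.

Lemma dot_eq0 (R : realType) (x : 'rV[R]_2) : (dot x x == 0) = (x == 0).
Proof.
apply/eqP/eqP => [|->]; last by rewrite -[0](scale0r (0 : 'rV[R]_2)) dotZl mul0r.
rewrite dot_sum_sqr => /eqP; rewrite psumr_eq0 => [/allP x0|j _]; last exact: sqr_ge0.
apply/rowP => j; rewrite mxE; apply/eqP.
by rewrite -sqrf_eq0; apply: x0; rewrite mem_index_enum.
Qed.

Lemma enorm_ge0 (R : realType) (x : 'rV[R]_2) : 0 <= enorm x.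
Proof. exact: sqrtr_ge0. Qed.

Lemma sqr_enorm (R : realType) (x : 'rV[R]_2) : enorm x ^+ 2 = dot x x.
Proof. by rewrite sqr_sqrtr // dot_ge0. Qed.

Lemma ler_enorm (R : realType) (x y : 'rV[R]_2) :
  (enorm x <= enorm y) = (dot x x <= dot y y).
Proof. by rewrite ler_sqrt // dot_ge0. Qed.

Lemma enormN (R : realType) (x : 'rV[R]_2) : enorm (- x) = enorm x.
Proof. by rewrite /enorm dotNl dotNr opprK. Qed.

Lemma dot_gt0 (R : realType) (x : 'rV[R]_2) : x != 0 -> 0 < dot x x.
Proof. by move=> x0; rewrite lt_neqAle dot_ge0 eq_sym dot_eq0 x0. Qed.

Lemma cauchy_schwarz (R : realType) (x y : 'rV[R]_2) :
  `|dot x y| <= enorm x * enorm y.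
Proof.
rewrite -ler_sqr ?nnegrE ?mulr_ge0 ?enorm_ge0 //.
rewrite exprMn !sqr_enorm real_normK ?num_real //.
have [->|y0] := eqVneq y 0.
  by rewrite -(scale0r (0 : 'rV[R]_2)) dotZr dotZl !mul0r expr0n mulr0.
have c0 := dot_gt0 y0.
(* This vector is the component of [x] orthogonal to [y], scaled by |y|^2. *)
have := dot_ge0 (dot y y *: x - dot x y *: y).
rewrite !dot_bilinear (dotC y x) => h; rewrite -subr_ge0 -(pmulr_rge0 _ c0).
by apply: le_trans h _; rewrite le_eqVlt; apply/orP; left; apply/eqP; ring.
Qed.

(** With [u = cos (pi / 3)], the duplication formula and
    [2 * pi / 3 = pi - pi / 3] give [2 * u ^+ 2 - 1 = - u], whose only
    nonnegative root is 1/2. *)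
Lemma cos_pi_third (R : realType) : cos (pi / 3) = 1 / 2 :> R.
Proof.
set u := cos _.
have pi0 := pi_gt0 R.
have u0 : 0 <= u by apply: cos_ge0_pihalf; apply/andP; split; lra.
have : cos (pi / 3 *+ 2) = - u :> R.
  by rewrite /u -[in RHS]cosN -[RHS]cosDpi; congr cos; field.
rewrite cos_mulr2n -/u => e.
have : (2 * u - 1) * (u + 1) = 0.
  by rewrite -[RHS](subrr (- u)) -[X in _ = X - _]e; ring.
by move=> /eqP; rewrite mulf_eq0 => /orP[] /eqP; lra.
Qed.

(** * Circumcenters of nonobtuse triangles *)

Definition gram (R : realType) (x y : 'rV[R]_2) : R :=
  dot x x * dot y y - dot x y ^+ 2.

(** The coefficient of [x] in the circumcenter of the triangle [0, x, y], by
    Cramer's rule; that of [y] is [circum_coord y x]. *)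
Definition circum_coord (R : realType) (x y : 'rV[R]_2) : R :=
  dot y y * (dot x x - dot x y) / (2 * gram x y).

Definition circumcenter (R : realType) (x y : 'rV[R]_2) : 'rV[R]_2 :=
  circum_coord x y *: x + circum_coord y x *: y.

(** Gauss reduction up to signs, without ordering the two vectors by length:
    neither |x - y| < |x| nor |x - y| < |y|, and the angle at [0] is not
    obtuse.  The symmetric form covers any basis of orthogonal vectors. *)
Definition reduced (R : realType) (x y : 'rV[R]_2) : Prop :=
  [/\ 0 <= dot x y, 2 * dot x y <= dot x x & 2 * dot x y <= dot y y].

Lemma reduced_sym (R : realType) (x y : 'rV[R]_2) : reduced x y -> reduced y x.
Proof. by case; rewrite /reduced (dotC y x). Qed.

Lemma gramC (R : realType) (x y : 'rV[R]_2) : gram x y = gram y x.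
Proof. by rewrite /gram (dotC y x) mulrC. Qed.

Lemma reduced_gram_gt0 (R : realType) (x y : 'rV[R]_2) :
  x != 0 -> y != 0 -> reduced x y -> 0 < gram x y.
Proof.
move=> x0 y0 [b0 ba bc].
have a0 := dot_gt0 x0.
have c0 := dot_gt0 y0.
by rewrite /gram; nra.
Qed.

Lemma circumcenter_dot (R : realType) (x y : 'rV[R]_2) :
  0 < gram x y -> dot (circumcenter x y) x = dot x x / 2.
Proof.
move=> g0; rewrite /circumcenter /circum_coord (gramC y x) !dot_bilinear (dotC y x).
have : gram x y != 0 by rewrite gt_eqF.
by rewrite /gram => ?; field.
Qed.

Lemma circumcenterC (R : realType) (x y : 'rV[R]_2) :
  circumcenter x y = circumcenter y x.
Proof. by rewrite /circumcenter addrC. Qed.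

(** With [p] the circumcenter of [0, x, y] and [w] in the triangle, the mean of
    the squared distances from [w] to [0], [x], [y] with weights [1 - s - t],
    [s], [t] is |p|^2 - |w - p|^2, by the parallel axis theorem; the
    smallest of the three is at most the mean. *)
Lemma triangle_dist (R : realType) (x y p w : 'rV[R]_2) (s t e : R) :
  dot p x = dot x x / 2 -> dot p y = dot y y / 2 ->
  w = s *: x + t *: y -> 0 <= s -> 0 <= t -> s + t <= 1 ->
  e <= dot w w -> e <= dot (w - x) (w - x) -> e <= dot (w - y) (w - y) ->
  e <= dot p p - dot (w - p) (w - p).
Proof.
move=> px py wE s0 t0 st e0 ex ey.
have ww : dot w w = s * dot w x + t * dot w y.
  by rewrite {2}wE !dot_bilinear.
have wp : dot w p = s * (dot x x / 2) + t * (dot y y / 2).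
  by rewrite wE !dot_bilinear -px -py !(dotC p).
rewrite !dot_bilinear !(dotC x w) !(dotC y w) !(dotC p w) in ex ey *.
have h : e <= (1 - s - t) * dot w w + s * (dot w w - dot w x - (dot w x - dot x x))
  + t * (dot w w - dot w y - (dot w y - dot y y)).
  have -> : e = (1 - s - t) * e + s * e + t * e by ring.
  by apply: lerD; [apply: lerD|]; apply: ler_wpM2l => //; lra.
by lra.
Qed.

(** * Lattices with a reduced basis *)

Lemma intmul_comb (R : realType) (x y : 'rV[R]_2) (m n : int) :
  x *~ m + y *~ n = m%:~R *: x + n%:~R *: y.
Proof. by rewrite !scaler_int. Qed.

Lemma int_sqrB_ge0 (m : int) : 0 <= m ^+ 2 - m.
Proof.
have -> : m ^+ 2 - m = m * (m - 1) by ring.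
by have [m0|m0] := lerP m 0; [apply: mulr_le0|apply: mulr_ge0]; lia.
Qed.

(** The minimum over the reals is -1/3, attained at [m = n = 1 / 3]; completing
    the square in [m] and using [n <= n ^+ 2] gives a bound above -1,
    which suffices for integers. *)
Lemma int_hexagonal_ge0 (m n : int) :
  0 <= m ^+ 2 - m + m * n + n ^+ 2 - n.
Proof.
set q := (X in 0 <= X).
have e : 4 * q = (2 * m + n - 1) ^+ 2 + 2 * (n ^+ 2 - n) + n ^+ 2 - 1.
  by rewrite /q; ring.
have h1 := sqr_ge0 (2 * m + n - 1); have h2 := sqr_ge0 n.
have h3 := int_sqrB_ge0 n; move: q e h1 h2 h3 => q.
by move: ((2 * m + n - 1) ^+ 2) (n ^+ 2 - n) (n ^+ 2) => S T U; lia.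
Qed.

Section LatticeBasis.
Variables (R : realType) (L : zmodClosed 'rV[R]_2) (x y : 'rV[R]_2).
Hypothesis bas : lattice_basis L x y.

Lemma lattice_basis_neq0 : x != 0 /\ y != 0.
Proof.
case: bas => fr _; have := fr; rewrite free_cons => /andP[_ fy].
have fr' : free [:: y; x].
  rewrite (perm_free (_ : perm_eq _ [:: x; y])) //.
  by rewrite (perm_catC [:: y] [:: x]).
split; last by move: fy; rewrite free_cons span_nil memv0 => /andP[].
move: fr'; rewrite free_cons => /andP[_].
by rewrite free_cons span_nil memv0 => /andP[].
Qed.

Lemma lattice_basis_span_fullv : (<<[:: x; y]>> = fullv)%VS.
Proof.
case: bas => fr _; apply/eqP; rewrite eqEdim subvf /=.
by move: fr; rewrite /free => /eqP ->; rewrite dimvf dim_matrix.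
Qed.

Lemma lattice_basis_coord (z : 'rV[R]_2) : exists s t, z = s *: x + t *: y.
Proof.
have : z \in fullv by rewrite memvf.
rewrite -lattice_basis_span_fullv span_cons span_seq1.
by case/memv_addP => _ /vlineP[s ->] [_ /vlineP[t ->] ->]; exists s, t.
Qed.

Lemma lattice_basis_coord_inj (s t s' t' : R) :
  s *: x + t *: y = s' *: x + t' *: y -> s = s' /\ t = t'.
Proof.
move=> e; case: bas; rewrite free_cons span_seq1 => /andP[xy _] _.
have [_ y0] := lattice_basis_neq0.
have e' : (s - s') *: x = (t' - t) *: y.
  by rewrite !scalerBl; apply/eqP; rewrite subr_eq addrAC -subr_eq opprK e addrC.
have ss : s = s'.
  apply/eqP; rewrite -subr_eq0; apply: contraNT xy => d0; apply/vlineP.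
  by exists ((s - s')^-1 * (t' - t)); rewrite -scalerA -e' scalerK.
split=> //; apply/eqP; move/eqP: e'; rewrite ss subrr scale0r eq_sym.
by rewrite scaler_eq0 (negPf y0) orbF subr_eq0 eq_sym.
Qed.

Lemma mem_lattice_basis (s t : R) :
  s *: x + t *: y \in L <-> s \is a Num.int /\ t \is a Num.int.
Proof.
case: bas => _ LP; split.
  case/LP => m [n]; rewrite intmul_comb => /lattice_basis_coord_inj[-> ->].
  by rewrite !rpred_int.
by case=> /intrP[m ->] /intrP[n ->]; apply/LP; exists m, n; rewrite intmul_comb.
Qed.

Lemma lattice_basis_mem1 : x \in L.
Proof.
have : 1 *: x + 0 *: y \in L by apply/mem_lattice_basis; rewrite rpred1 rpred0.
by rewrite scale1r scale0r addr0.
Qed.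

Lemma lattice_basis_mem2 : y \in L.
Proof.
have : 0 *: x + 1 *: y \in L by apply/mem_lattice_basis; rewrite rpred1 rpred0.
by rewrite scale1r scale0r add0r.
Qed.

(** Reduce to the fundamental parallelogram by taking floors of the
    coordinates; the point reflection exchanging [0] and [x + y] swaps the two
    triangles into which the diagonal cuts it. *)
Lemma triangle_mod_lattice (z : 'rV[R]_2) :
  exists (v w : 'rV[R]_2) (s t : R), [/\ v \in L, z = v + w \/ z = v - w,
    w = s *: x + t *: y, 0 <= s /\ 0 <= t & s + t <= 1].
Proof.
have [s0 [t0 ->]] := lattice_basis_coord z.
have /andP[] := floor_itv s0; have /andP[] := floor_itv t0.
set m := Num.floor s0; set n := Num.floor t0; rewrite !intrD => n0 n1 m0 m1.
set s := s0 - m%:~R; set t := t0 - n%:~R.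
have [le1|gt1] := lerP (s + t) 1.
  exists (m%:~R *: x + n%:~R *: y), (s *: x + t *: y), s, t.
  split=> //; first by apply/mem_lattice_basis; rewrite !rpred_int.
    by left; rewrite addrACA -!scalerDl /s /t !(addrC _%:~R) !subrK.
  by split; rewrite /s /t; lra.
exists ((m%:~R + 1) *: x + (n%:~R + 1) *: y),
  ((1 - s) *: x + (1 - t) *: y), (1 - s), (1 - t).
split=> //; first by apply/mem_lattice_basis; rewrite !rpredD ?rpred_int ?rpred1.
- right; rewrite opprD addrACA -!scalerBl /s /t.
  by congr (_ *: _ + _ *: _); ring.
- by split; rewrite /s /t; lra.
- by lra.
Qed.

Hypothesis red : reduced x y.

Let gram_gt0 : 0 < gram x y.
Proof. by case: lattice_basis_neq0 => x0 y0; apply: reduced_gram_gt0. Qed.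

Lemma circumcenter_dot1 : dot (circumcenter x y) x = dot x x / 2.
Proof. exact: circumcenter_dot. Qed.

Lemma circumcenter_dot2 : dot (circumcenter x y) y = dot y y / 2.
Proof. by rewrite circumcenterC; apply: circumcenter_dot; rewrite gramC. Qed.

(** For [v = m x + n y], writing [a], [b], [c] for [dot x x], [dot x y],
    [dot y y], the difference of the two sides is
    [(m ^+ 2 - m) * a + 2 * m * n * b + (n ^+ 2 - n) * c].  The outer
    coefficients are nonnegative, so replacing [a] and [c] by their lower bound
    [2 * b] leaves [2 * b] times the integer form of [int_hexagonal_ge0]. *)
Lemma empty_circumcircle (v : 'rV[R]_2) : v \in L ->
  dot (circumcenter x y) (circumcenter x y) <=
  dot (v - circumcenter x y) (v - circumcenter x y).
Proof.
case: bas => _ LP /LP[m [n ->]]; rewrite intmul_comb.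
move: (circumcenter x y) circumcenter_dot1 circumcenter_dot2 => p px py.
set M := m%:~R; set N := n%:~R.
suff : 0 <= (M ^+ 2 - M) * dot x x + 2 * M * N * dot x y + (N ^+ 2 - N) * dot y y.
  rewrite !dot_bilinear (dotC x p) (dotC y p) px py (dotC y x) => h.
  rewrite -subr_ge0; apply: (le_trans h); rewrite le_eqVlt; apply/orP; left; apply/eqP.
  by field.
case: red => b0 ba bc.
have hm : 0 <= M ^+ 2 - M :> R by rewrite /M -rmorphXn -rmorphB ler0z int_sqrB_ge0.
have hn : 0 <= N ^+ 2 - N :> R by rewrite /N -rmorphXn -rmorphB ler0z int_sqrB_ge0.
have hmn : 0 <= M ^+ 2 - M + M * N + N ^+ 2 - N :> R.
  by rewrite /M /N -!rmorphXn -!(rmorphB, rmorphD, rmorphM) ler0z int_hexagonal_ge0.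
apply: (@le_trans _ _ ((M ^+ 2 - M + M * N + N ^+ 2 - N) * (2 * dot x y))).
  by rewrite mulr_ge0 // mulr_ge0.
have h1 := ler_wpM2l hm ba; have h2 := ler_wpM2l hn bc.
by lra.
Qed.

End LatticeBasis.

(** * Deep holes *)

(** By [empty_circumcircle] the covering radius is at least |p|, and by
    [triangle_dist] a point of the triangle other than [p] is at distance less
    than |p| from one of its vertices. *)
Lemma deep_hole_circumcenter (R : realType) (L : zmodClosed 'rV[R]_2)
    (x y z : 'rV[R]_2) :
  lattice_basis L x y -> reduced x y -> deep_hole L z ->
  z - circumcenter x y \in L \/ z + circumcenter x y \in L.
Proof.
move=> bas red [d [[_ dmin] [_ dmax]]].
have empty := empty_circumcircle bas red.
move: (circumcenter x y) (circumcenter_dot1 bas red) (circumcenter_dot2 bas red)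
  empty => p px py empty.
have pd : enorm p <= d.
  apply: dmax; exists p; split; first by exists 0; rewrite /= ?rpred0 // sub0r enormN.
  by move=> _ [v vL <-]; rewrite ler_enorm; apply: empty.
have [v [w [s [t [vL zE wE [s0 t0] st]]]]] := triangle_mod_lattice bas z.
have wL u : u \in L -> dot p p <= dot (w - u) (w - u).
  move=> uL; rewrite -ler_enorm; apply: le_trans pd _.
  apply: dmin; case: zE => ->; [exists (v + u) => /=|exists (v - u) => /=];
    rewrite ?rpredB ?rpredD //.
    by rewrite -enormN opprB opprD addrACA subrr add0r.
  by rewrite opprB addrC addrA subrK.
have wp : w = p.
  apply/eqP; rewrite -subr_eq0 -dot_eq0 eq_le dot_ge0 andbT.
  have := triangle_dist px py wE s0 t0 st _ (wL _ (lattice_basis_mem1 bas))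
    (wL _ (lattice_basis_mem2 bas)).
  have := wL 0 (rpred0 _); rewrite subr0 => w0 /(_ w0).
  by rewrite lerBrDl gerDr.
by rewrite -wp; case: zE => ->; [left; rewrite addrK|right; rewrite subrK].
Qed.

(** * Minimal bases are reduced *)

Lemma is_min_uniq d (T : porderType d) (A : set T) (m m' : T) :
  is_min A m -> is_min A m' -> m = m'.
Proof.
by move=> [Am lm] [Am' lm']; apply/eqP; rewrite eq_le lm //= lm'.
Qed.

Lemma minimal_basis_norm_le (R : realType) (L : zmodClosed 'rV[R]_2)
    (x y : 'rV[R]_2) :
  minimal_basis L x y -> dot x x <= dot y y.
Proof.
case=> _ [_ min1] [[W [spanW dimW]] _] _.
by rewrite -ler_enorm; apply: min1; exists W; split=> //; apply: ltnW.
Qed.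

(** If both [x] and [y - x] were shorter than [y], these two independent lattice
    vectors would lie in a disc of radius less than the second minimum. *)
Lemma minimal_basis_sub_ge (R : realType) (L : zmodClosed 'rV[R]_2)
    (x y : 'rV[R]_2) :
  minimal_basis L x y -> enorm x < enorm y -> enorm y <= enorm (y - x).
Proof.
case=> bas _ [_ min2] _ xy.
suff : enorm y <= Num.max (enorm x) (enorm (y - x)).
  by rewrite le_max (leNgt _ (enorm x)) xy.
apply: min2; exists fullv; split; last by rewrite dimvf dim_matrix.
split=> [v _|W WP]; first exact: memvf.
have xW : x \in W.
  apply: WP; split; last exact: lattice_basis_mem1 bas.
  by rewrite /closed_disc /= le_max lexx.
have yxW : y - x \in W.
  apply: WP; split.
    by rewrite /closed_disc /= le_max lexx orbT.
  by rewrite /= rpredB // ?(lattice_basis_mem1 bas) ?(lattice_basis_mem2 bas).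
rewrite -(lattice_basis_span_fullv bas); apply/span_subvP => v.
by rewrite !inE => /orP[] /eqP -> //; rewrite -(subrK x y) rpredD.
Qed.

(** If |x| < |y|, the bound [2 * dot x y <= dot x x] comes from
    |y| <= |y - x|; if |x| = |y|, it comes from the angle being at
    least [pi / 3]. *)
Lemma minimal_basis_reduced (R : realType) (L : zmodClosed 'rV[R]_2)
    (x y : 'rV[R]_2) :
  minimal_basis L x y -> reduced x y.
Proof.
move=> mb; have ac := minimal_basis_norm_le mb.
have yx := minimal_basis_sub_ge mb.
case: mb => bas _ _ /andP[angle_ge angle_le].
have [x0 y0] := lattice_basis_neq0 bas.
have n0 : 0 < enorm x * enorm y.
  by rewrite mulr_gt0 // sqrtr_gt0 dot_gt0.
have cs : -1 <= dot x y / (enorm x * enorm y) <= 1.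
  by rewrite -ler_norml normrM normfV (gtr0_norm n0) ler_pdivrMr // mul1r cauchy_schwarz.
have cosE : cos (vangle x y) = dot x y / (enorm x * enorm y).
  by apply: acosK; rewrite in_itv.
have pi0 := pi_gt0 R.
have b0 : 0 <= dot x y.
  rewrite -(pmulr_lge0 _ (_ : 0 < (enorm x * enorm y)^-1)) ?invr_gt0 // -cosE.
  by apply: cos_ge0_pihalf; apply/andP; split; lra.
have b2 : 2 * dot x y <= enorm x * enorm y.
  have : cos (vangle x y) <= cos (pi / 3).
    rewrite leNgt ltr_cos ?in_itv /= -?leNgt //; apply/andP; split; lra.
  rewrite cosE cos_pi_third ler_pdivrMr //; lra.
have ba : 2 * dot x y <= dot x x.
  have [xy|yx'] := ltP (enorm x) (enorm y).
    move: (yx xy); rewrite ler_enorm !dot_bilinear (dotC y x); lra.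
  have e : enorm x = enorm y by apply/eqP; rewrite eq_le yx' andbT ler_enorm.
  by move: b2; rewrite -e -expr2 sqr_enorm.
by split=> //; apply: le_trans ba ac.
Qed.

(** * Orders in the quotient group *)

Lemma lattice_coset_eq0 (R : realType) (L : zmodClosed 'rV[R]_2)
    (z : 'rV[R]_2) (n : nat) :
  lattice_coset L z *+ n = 0 <-> z *+ n \in L.
Proof.
have -> : lattice_coset L z *+ n = lattice_coset L (z *+ n).
  elim: n => [|n IH]; first by rewrite !mulr0n /lattice_coset piE.
  by rewrite !mulrS IH /lattice_coset piE.
have <- : lattice_coset L 0 = 0 by rewrite /lattice_coset piE.
rewrite -[X in X \in _]subr0 Quotient.idealrBE.
by split=> [/eqP|/eqP].
Qed.

Lemma has_order_le (G : zmodType) (g : G) (n : nat) :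
  (0 < n)%N -> g *+ n = 0 -> exists m, has_order g m /\ (m <= n)%N.
Proof.
move=> n0 gn.
have ex : exists m, (0 < m)%N && (g *+ m == 0) by exists n; rewrite n0 gn eqxx.
exists (ex_minn ex); case: ex_minnP => m /andP[m0 /eqP gm] mmin; split.
  split=> // k [k0 /eqP gk]; rewrite leEnat; apply: mmin; exact/andP.
by apply: mmin; rewrite n0 gn eqxx.
Qed.

Lemma deep_hole_coset_mulrn (R : realType) (L : zmodClosed 'rV[R]_2)
    (x y z : 'rV[R]_2) (n : nat) :
  lattice_basis L x y -> reduced x y -> deep_hole L z ->
  lattice_coset L z *+ n = 0 <->
    n%:R * circum_coord x y \is a Num.int /\
    n%:R * circum_coord y x \is a Num.int.
Proof.
move=> bas red dh; rewrite lattice_coset_eq0.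
rewrite -(mem_lattice_basis bas) -!(scalerA n%:R) -scalerDr scaler_nat -/(circumcenter x y).
case: (deep_hole_circumcenter bas red dh) => /(rpredMn n) h.
  by rewrite -[z](subrK (circumcenter x y)) mulrnDl rpredDl.
by rewrite -[z](addrK (circumcenter x y)) mulrnBl rpredDl // rpredN.
Qed.

Lemma reduced_circum_coord_gt0 (R : realType) (x y : 'rV[R]_2) :
  x != 0 -> y != 0 -> reduced x y -> 0 < circum_coord x y.
Proof.
move=> x0 y0 red; have g0 := reduced_gram_gt0 x0 y0 red.
case: red => b0 ba bc.
have a0 := dot_gt0 x0.
have c0 := dot_gt0 y0.
by rewrite /circum_coord divr_gt0 ?mulr_gt0 //; lra.
Qed.

(** * Rational coordinates and finite order *)

Lemma rational_of_int_multiple (R : realType) (n : nat) (s : R) :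
  (0 < n)%N -> n%:R * s \is a Num.int -> exists q : rat, s = ratr q.
Proof.
move=> n0 /intrP[m ms]; exists (m%:~R / n%:R).
rewrite fmorph_div /= ratr_int ratr_nat -ms mulrAC divff ?mul1r // pnatr_eq0.
by rewrite -lt0n.
Qed.

Lemma int_multiple_of_rational (R : realType) (p q : rat) :
  exists n : nat, [/\ (0 < n)%N, n%:R * ratr p \is a @Num.int R
    & n%:R * ratr q \is a @Num.int R].
Proof.
exists (`|denq p| * `|denq q|)%N; split.
- by rewrite muln_gt0 !absz_gt0 !denq_eq0.
- rewrite natrM mulrAC (_ : _ * ratr p = (numq p)%:~R) ?rpredM ?rpred_int ?rpred_nat //.
  by rewrite pmulrn absz_denq mulrC -[RHS]ratr_int numqE rmorphM /= ratr_int.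
rewrite natrM -mulrA (_ : _ * ratr q = (numq q)%:~R) ?rpredM ?rpred_int ?rpred_nat //.
by rewrite pmulrn absz_denq mulrC -[RHS]ratr_int numqE rmorphM /= ratr_int.
Qed.

Theorem theorem4p3 (R : realType) (L : zmodClosed 'rV[R]_2)
    (hL : full_rank_lattice L) (l1 l2 : R)
    (hl1 : successive_minimum L 1 l1) (hl2 : successive_minimum L 2 l2)
    (x1 x2 : 'rV[R]_2) (hx : minimal_basis L x1 x2)
    (z : 'rV[R]_2) (hz : deep_hole L z) :
  (finite_order (lattice_coset L z) <->
     orthogonal_lattice L \/
     exists p q : rat,
       ratr p * l1 ^+ 2 = dot x1 x2 /\ dot x1 x2 = ratr q * l2 ^+ 2) /\
  (l1 ^+ 2 \is a Num.int -> l2 ^+ 2 \is a Num.int ->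
   dot x1 x2 \is a Num.int ->
   exists n : nat, has_order (lattice_coset L z) n /\
     n%:R <= 12 * Num.sqrt 3 * l2 ^+ 4).
Proof.
have red := minimal_basis_reduced hx; have ac := minimal_basis_norm_le hx.
have [bas min1 min2 _] := hx.
have coset n := deep_hole_coset_mulrn n bas red hz.
have -> : l2 ^+ 4 = (l2 ^+ 2) ^+ 2 by rewrite -exprM.
rewrite (is_min_uniq hl1 min1) (is_min_uniq hl2 min2) !sqr_enorm.
have [x0 y0] := lattice_basis_neq0 bas.
have g0 := reduced_gram_gt0 x0 y0 red.
have s0 := reduced_circum_coord_gt0 x0 y0 red.
have t0 := reduced_circum_coord_gt0 y0 x0 (reduced_sym red).
have eqx := circumcenter_dot1 bas red; have eqy := circumcenter_dot2 bas red.
have a0 : dot x1 x1 != 0 by rewrite dot_eq0.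
have c0 : dot x2 x2 != 0 by rewrite dot_eq0.
rewrite /circumcenter !dot_bilinear in eqx eqy.
rewrite (dotC x2 x1) in eqx.
split; first split.
- case=> n [n0 /coset[ns nt]]; right.
  have [p pE] := rational_of_int_multiple n0 ns.
  have [q qE] := rational_of_int_multiple n0 nt.
  (* Here [p] and [q] are the coordinates of the circumcenter; the first of its
     two equations gives [b / a], the second [b / c]. *)
  move: eqx eqy s0 t0; rewrite pE qE => eqx eqy p0 q0.
  have p0' := lt0r_neq0 p0; have q0' := lt0r_neq0 q0.
  exists ((1 / 2 - p) / q), ((1 / 2 - q) / p).
  rewrite !fmorph_div !rmorphB !fmorph_div /= rmorph1 ratr_nat; split.
    by apply: (mulfI q0'); rewrite mulrA mulrCA mulrA mulfK //; lra.
  by apply: (mulfI p0'); rewrite mulrA mulrCA mulrA mulfK //; lra.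
- case=> [[y1 [y2 [bas' orth]]]|[p [q [pE qE]]]].
    have red' : reduced y1 y2 by rewrite /reduced orth mulr0 lexx !dot_ge0.
    (* The circumcenter of an orthogonal basis has coordinates 1/2, 1/2. *)
    exists 2; split=> //; apply/(deep_hole_coset_mulrn 2 bas' red' hz).
    have [u0 v0] := lattice_basis_neq0 bas'.
    rewrite /circum_coord /gram (dotC y2 y1) orth.
    have a' : dot y1 y1 != 0 by rewrite dot_eq0.
    have c' : dot y2 y2 != 0 by rewrite dot_eq0.
    have one k : k = 1 -> k \is a @Num.int R by move=> ->; rewrite rpred1.
    by split; apply: one; field; rewrite a' c'.
  set s := (1 - p) / (2 * (1 - p * q)).
  set t := (1 - q) / (2 * (1 - p * q)).
  have gE : gram x1 x2 = dot x1 x1 * dot x2 x2 * (1 - ratr p * ratr q).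
    have b2 : dot x1 x2 ^+ 2 = ratr p * dot x1 x1 * (ratr q * dot x2 x2).
      by rewrite pE -qE expr2.
    by rewrite /gram b2; ring.
  have pq : 1 - ratr p * ratr q != 0 :> R.
    by apply: contraTneq g0 => pq; rewrite gE pq mulr0 ltxx.
  have sE : circum_coord x1 x2 = ratr s.
    rewrite /s !(fmorph_div, rmorphB, rmorphM) /= !rmorph1 ratr_nat.
    by rewrite /circum_coord gE -pE; field; rewrite a0 c0 pq.
  have tE : circum_coord x2 x1 = ratr t.
    rewrite /t !(fmorph_div, rmorphB, rmorphM) /= !rmorph1 ratr_nat.
    by rewrite /circum_coord gramC gE dotC qE; field; rewrite a0 c0 pq.
  have [n [n0 ns nt]] := int_multiple_of_rational R s t.
  by exists n; split=> //; apply/coset; rewrite sE tE.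
move=> aZ cZ bZ.
have /intrP[m mE] : 2 * gram x1 x2 \is a Num.int.
  by rewrite /gram rpredM ?rpred_nat // rpredB ?rpredM ?rpredX.
have m0 : 0 < m by rewrite -(ltr0z R) -mE mulr_gt0.
have nE : `|m|%:R = 2 * gram x1 x2 :> R by rewrite mE pmulrn gtz0_abs.
have [||n [ordn le_n]] := @has_order_le _ (lattice_coset L z) `|m|%N.
- by rewrite absz_gt0 gt_eqF.
- have g_neq0 : gram x1 x2 != 0 by rewrite gt_eqF.
  apply/coset; rewrite nE /circum_coord (gramC x2 x1) (dotC x2 x1); split.
    rewrite mulrC divfK ?mulf_neq0 ?pnatr_eq0 //.
    by rewrite rpredM // rpredB.
  rewrite mulrC divfK ?mulf_neq0 ?pnatr_eq0 //.
  by rewrite rpredM // rpredB.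
exists n; split=> //.
have sqrt3_ge1 : 1 <= Num.sqrt 3 :> R by rewrite -[X in X <= _]sqrtr1 ler_wsqrtr // ler1n.
apply: (@le_trans _ _ (2 * gram x1 x2)); first by rewrite -nE ler_nat.
have gram_le : gram x1 x2 <= dot x2 x2 ^+ 2.
  rewrite /gram expr2 lerBlDr (le_trans (ler_wpM2r (dot_ge0 x2) ac)) //.
  by rewrite lerDl sqr_ge0.
have := sqr_ge0 (dot x2 x2).
have : 0 <= (Num.sqrt 3 - 1) * dot x2 x2 ^+ 2.
  by rewrite mulr_ge0 ?sqr_ge0 ?subr_ge0.
by lra.
Qed.
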